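(* Let $d\ge 1$ be an integer, $a>0$, $\lambda>0$ and $0<\epsilon<a/4$. Let $\omega$ be a Poisson point process on the torus $\mathbb{T}_a^d$ with intensity measure $\lambda\,dx$, and let $\beta_0$ be the zeroth Betti number (the number of connected components) of the Čech complex $\mathcal{C}_\epsilon(\omega)$. Then for every real $y>\lambda a^d$, $$\mathbf{P}(\beta_0\ge y)\le\exp\left(-\frac{y-\lambda a^d}{2}\,\log\left(1+\frac{y-\lambda a^d}{(2^d-1)^2\,\lambda a^d}\right)\right).$$
   Context: $\mathbb{T}_a^d=\mathbb{R}^d/a\mathbb{Z}^d$, identified with $X=[0,a)^d$, is equipped with Lebesgue measure and the distance $\rho_d(x,y)=\inf_{m\in\mathbb{Z}^d}\|x-y+ma\|_\infty$. For a finite set $\omega\subset\mathbb{T}_a^d$, the Čech complex $\mathcal{C}_\epsilon(\omega)$ is the abstract simplicial complex with vertex set $\omega$ in which distinct points $v_0,\dots,v_k\in\omega$ form a $k$-simplex if and only if $\bigcap_{i=0}^k B(v_i,\epsilon)\neq\emptyset$, where $B(v,\epsilon)=\{y:\rho_d(v,y)<\epsilon\}$. A Poisson point process with intensity measure $\lambda\,dx$ is a random finite set $\omega$ such that the number of points in any Borel set $A$ is Poisson with mean $\lambda|A|$, with independence over disjoint sets. *)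

(* Defs.v *)
From HB Require Import structures.
From mathcomp Require Import all_boot all_order all_algebra finmap.
From mathcomp Require Import all_classical all_reals all_analysis.

Set Implicit Arguments.
Unset Strict Implicit.
Unset Printing Implicit Defensive.

Import Order.TTheory GRing.Theory Num.Def Num.Theory.
Import numFieldNormedType.Exports.

Local Open Scope classical_set_scope.
Local Open Scope ring_scope.

Section Independence.
Context {d d'} {T : measurableType d} {T' : measurableType d'} {R : realType}.
Variable P : probability T R.

(* The events [B i] may be the full space, so the product rule for the whole
   family contains the product rule for every subfamily. *)
Definition mutually_independent (n : nat) (X : 'I_n -> T -> T') : Prop :=
  forall B : 'I_n -> set T', (forall i, measurable (B i)) ->
    P (\bigcap_i (X i @^-1` B i)) = (\prod_(i < n) P (X i @^-1` B i))%E.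

End Independence.

Section PoissonProcess.
Context {d d'} {T : measurableType d} {E : measurableType d'} {R : realType}.

Definition count_in (A : set E) (w : {fset E}) : nat :=
  #|` [fset x in w | x \in A]%fset |.

(* [mu] is meant to be finite on the measurable subsets of [D].  The [nat]
   argument of [poisson_prob] is not used by its definition; for mean 0 it is
   the Dirac measure at 0. *)
Record poisson_process (P : probability T R) (D : set E)
    (mu : set E -> \bar R) (w : T -> {fset E}) : Prop := {
  pp_carrier : forall t, [set` w t] `<=` D ;
  pp_measurable : forall A, measurable A -> A `<=` D ->
    measurable_fun setT (fun t => count_in A (w t)) ;
  pp_poisson : forall A, measurable A -> A `<=` D -> forall B : set nat,
    P ((fun t => count_in A (w t)) @^-1` B) =
    poisson_prob (fine (mu A)) 0%N B ;
  pp_independent : forall (n : nat) (A : 'I_n -> set E),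
    (forall i, measurable (A i)) -> (forall i, A i `<=` D) ->
    trivIset setT A ->
    mutually_independent P (fun i t => count_in (A i) (w t)) }.

End PoissonProcess.

(* d-fold product of the one-dimensional Lebesgue measure; the sigma-algebra
   on tuples is the one generated by the coordinates. *)
Fixpoint lebesgue_tuple (R : realType) (d : nat) :
    set (d.-tuple (measurableTypeR R)) -> \bar R :=
  match d with
  | 0 => \d_[tuple]
  | n.+1 => pushforward
      (product_measure1 (@lebesgue_measure R) (@lebesgue_tuple R n))
      (fun p => [tuple of p.1 :: p.2])
  end.

Section Torus.
Context {R : realType} (d : nat).
Local Notation point := (d.-tuple (measurableTypeR R)).
Implicit Types (a eps : R) (x y : point).

(* The torus R^d / a Z^d is represented by the fundamental domain [0, a)^d;
   its Borel sets are the Borel subsets of R^d contained in it. *)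
Definition torus a : set point := [set x | forall i, 0 <= tnth x i < a].

Definition torus_dist a x y : R :=
  inf (range (fun m : 'I_d -> int =>
    \big[Num.max/0]_(i < d) `|tnth x i - tnth y i + (m i)%:~R * a|)).

Definition torus_ball a eps x : set point :=
  [set y | torus a y /\ torus_dist a x y < eps].

Definition cech_complex a eps (w : {fset point}) : {set {set w}} :=
  [set s : {set w} | (0 < #|s|)%N &&
    `[< \bigcap_(v in [set` s]) torus_ball a eps (val v) !=set0 >]]%SET.

End Torus.

(* Number of connected components of an abstract simplicial complex, given by
   its set of simplices: components of its 1-skeleton. *)
Definition betti0 (V : finType) (K : {set {set V}}) : nat :=
  n_comp [rel u v : V | [set u; v]%SET \in K] [pred v | [set v]%SET \in K].

(* Main.v *)
(* The Betti number is at most the number of points, which is Poisson with mean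
   m = lambda a^d.  The Chernoff bound
   P(N >= y) <= exp(y - m - y ln(y/m)), together with
   ln x >= 2(x - 1)/(x + 1) for x >= 1, already gives the claim, since
   (2^d - 1)^2 >= 1.

   The event {beta_0 >= y} must moreover be shown measurable in terms of the
   counts alone, as nothing is known about P on non-measurable sets.  The
   relation "the balls around x and y meet" is open, so beta_0 is eventually
   equal to the number of components of the graph of occupied cells of the grid
   with n + 1 cells per side, two cells being adjacent when all their points
   are related; that number depends only on finitely many counts. *)
Require Import Defs.
From mathcomp Require Import all_boot all_order all_algebra finmap.
From mathcomp Require Import all_classical all_reals all_analysis.
From mathcomp Require Import measurable_realfun ring lra.

Set Implicit Arguments.
Unset Strict Implicit.
Unset Printing Implicit Defensive.

Import Order.TTheory GRing.Theory Num.Def Num.Theory.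
Import numFieldNormedType.Exports.

Local Open Scope classical_set_scope.
Local Open Scope ring_scope.

(** * A logarithm inequality and the Poisson tail *)

(** With $f(z) = \ln z + 4/(z+1)$ the difference of the two sides is $f(x) - f(1)$, and $f'(z) =
    (z-1)^2/(z(z+1)^2) \ge 0$. *)
Lemma ln_ge_pade (R : realType) (x : R) :
  1 <= x -> 2 * (x - 1) / (x + 1) <= ln x.
Proof.
move=> x1; rewrite -subr_ge0.
pose f (z : R) := ln z + 4 * (z + 1)^-1.
pose df (z : R) := z^-1 - 4 / (z + 1) ^+ 2.
have dfE (z : R) : 0 < z -> is_derive z 1 f (df z).
  move=> z0; have z10 : z + 1 != 0 by rewrite gt_eqF// addr_gt0.
  have dln := is_derive1_ln z0.
  have dV : is_derive z 1 (fun u : R => (u + 1)^-1) (- (z + 1) ^- 2).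
    have d1 : is_derive z 1 (fun u : R => u + 1) 1.
      by apply: is_derive_eq; rewrite addr0.
    have := @is_deriveV _ (fun u : R => u + 1) z 1 1 z10 d1.
    by rewrite [_ *: _]mulr1; exact.
  have -> : df z = z^-1 + 4 *: (- (z + 1) ^- 2) by rewrite /df -mulrN.
  exact: is_deriveD.
have : f 1 <= f x.
  apply: (@ger0_derive1_ndecr _ f 1 x) => // [z|z|].
  - by rewrite in_itv/= => /andP[z1 _]; have [] := dfE z (lt_trans ltr01 z1).
  - rewrite in_itv/= => /andP[z1 _]; have z0 := lt_trans ltr01 z1.
    rewrite derive1E (@derive_val _ _ _ _ _ _ _ (dfE z z0)) /df.
    have -> : z^-1 - 4 / (z + 1) ^+ 2 = (z - 1) ^+ 2 / (z * (z + 1) ^+ 2).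
      by field; rewrite !gt_eqF// addr_gt0.
    by rewrite divr_ge0 ?sqr_ge0 ?(mulr_ge0 (ltW z0)) ?sqr_ge0.
  - apply: derivable_within_continuous => z; rewrite in_itv/= => /andP[z1 _].
    by have [] := dfE z (lt_le_trans ltr01 z1).
rewrite /f ln1 -subr_ge0; congr (_ <= _); field.
by rewrite gt_eqF// addr_gt0// (lt_le_trans ltr01).
Qed.

(* Chernoff bound by change of measure: for [k >= y] the weight of rate [m] is at
   most [C] times the weight of rate [y], and the latter have total mass 1. *)
Lemma poisson_tail (R : realType) (m y : R) : 0 < m -> m < y ->
  (poisson_prob m 0%N [set k : nat | (y <= k%:R)%R] <=
   (expR (y - m - y * ln (y / m)))%:E)%E.
Proof.
move=> m0 my; have y0 := lt_trans m0 my.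
set C := expR _.
have r1 : 1 < y / m by rewrite ltr_pdivlMr// mul1r.
have lnr : 0 <= ln (y / m) by rewrite ln_ge0 ?ltW.
have pmfle k : y <= k%:R -> poisson_pmf m k <= C * poisson_pmf y k.
  move=> yk; rewrite /poisson_pmf m0 y0.
  have -> : y ^+ k = expR (k%:R * ln (y / m)) * m ^+ k.
    rewrite mulrC expRM_natl lnK; first by rewrite -exprMn mulrC divfK ?gt_eqF.
    by rewrite posrE (lt_trans ltr01).
  (* The ratio of the two weights becomes [expR ((k%:R - y) * ln (y / m))], which is at least 1
     because [y <= k%:R]. *)
  have -> : C * (expR (k%:R * ln (y / m)) * m ^+ k / k`!%:R * expR (- y)) =
            m ^+ k / k`!%:R * expR (- m) * expR ((k%:R - y) * ln (y / m)).
    rewrite /C; transitivity (m ^+ k / k`!%:R *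
      (expR (y - m - y * ln (y / m)) * expR (k%:R * ln (y / m)) * expR (- y))).
      by ring.
    rewrite -[RHS]mulrA -!expRD; congr (_ * expR _); ring.
  rewrite ler_peMr//; last by rewrite -[leLHS]expR0 ler_expR mulr_ge0// subr_ge0.
  by rewrite mulr_ge0 ?expR_ge0// divr_ge0// exprn_ge0// ltW.
(* The probability is a supremum of finite sums, so bounding each one suffices; [F] has mass at most
   1 at rate [y]. *)
rewrite {1}/poisson_prob m0; apply: ge_ereal_sup => _ /= [F [finF FU] <-].
apply: (@le_trans _ _ (\sum_(k \in F) C%:E * (poisson_pmf y k)%:E)%E).
  by apply: lee_fsum => // k Fk; rewrite -EFinM lee_fin pmfle//; exact: FU.
rewrite -ge0_mule_fsumr; last by move=> k; exact: poisson_pmf_ge0.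
rewrite -esum_fset//; last by move=> k _; exact: poisson_pmf_ge0.
have F1 : (poisson_prob y 0%N F <= 1)%E by exact: probability_le1.
rewrite /poisson_prob y0 in F1.
by rewrite -[leRHS]mule1; apply: lee_wpmul2l => //; exact: expR_ge0.
Qed.

(** * Component counts under a quotient of graphs *)

(** Reflexivity of the pulled-back relation [e'] makes any two vertices of a fibre of [h] adjacent,
    so collapsing fibres neither merges nor splits components. The adjunction uses a chosen section
    of [h] over [A]. *)
Lemma n_comp_quotient (T T' : finType) (h : T' -> T) (e : rel T) (e' : rel T')
    (A : {pred T}) :
  symmetric e -> symmetric e' -> reflexive e' ->
  (forall x y, e x y -> (x \in A) && (y \in A)) ->
  (forall x, reflect (exists u, h u = x) (x \in A)) ->
  (forall u v, e' u v = e (h u) (h v)) ->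
  n_comp e' predT = n_comp e A.
Proof.
move=> se se' re' eA hA ee'.
have clA : fingraph.closed e A by move=> x y /eA /andP[-> ->].
have hP x (Ax : x \in A) : {u | h u == x}.
  by apply: sigW; have /hA[u <-] := Ax; exists u.
have conn u v : h u = h v -> connect e' u v.
  by move=> huv; apply: connect1; rewrite ee' huv -ee'.
have adj : rel_adjunction h e e' A.
  apply: (intro_adjunction (sym_connect_sym se') clA
    (fun x Ax => sval (hP x Ax))).
  - move=> x Ax; case: (hP x Ax) => u /= /eqP hu; rewrite hu; split => // z Az exz.
    by case: (hP z Az) => v /= /eqP hv; apply: connect1; rewrite ee' hu hv.
  - move=> u Au; case: (hP (h u) Au) => v /= /eqP hv; split; first exact: conn.
    by move=> v' uv'; apply: connect1; rewrite -ee'.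
rewrite (adjunction_n_comp h (sym_connect_sym se) (sym_connect_sym se') clA adj).
by apply: eq_n_comp_r => u; rewrite !inE; apply/esym/hA; exists u.
Qed.

(** * The intersection graph of balls on the torus *)

Section CechGraph.
Context {R : realType} (d : nat) (a eps : R).
Hypotheses (a0 : 0 < a) (eps0 : 0 < eps).
Local Notation point := (d.-tuple (measurableTypeR R)).
Implicit Types x y z : point.

Definition balls_meet x y : bool :=
  `[< torus_ball a eps x `&` torus_ball a eps y !=set0 >].

Lemma balls_meetC : symmetric balls_meet.
Proof. by move=> x y; rewrite /balls_meet setIC. Qed.

Lemma torus_dist_lt x y (r : R) : torus_dist a x y < r ->
  exists m : 'I_d -> int, forall i, `|tnth x i - tnth y i + (m i)%:~R * a| < r.
Proof.
move=> /inf_lt[|_ [m _ <-] /bigmax_ltP[_ mr]]; last by exists m => i; exact: mr.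
by eexists; exists (fun=> 0).
Qed.

Lemma lt_torus_dist x y (r : R) (m : 'I_d -> int) : 0 < r ->
  (forall i, `|tnth x i - tnth y i + (m i)%:~R * a| < r) -> torus_dist a x y < r.
Proof.
(* [0 < r] takes care of the default value 0 of the maximum. *)
move=> r0 mr; apply: le_lt_trans (_ : \big[Num.max/0]_(i < d)
  `|tnth x i - tnth y i + (m i)%:~R * a| < r); last by apply: bigmax_lt.
apply: ge_inf; last by exists m.
by exists 0 => _ [m' _ <-]; exact: bigmax_ge_id.
Qed.

Lemma balls_meet_refl x : torus a x -> balls_meet x x.
Proof.
move=> xa; rewrite /balls_meet setIid; apply/asboolP; exists x; split => //.
apply: (@lt_torus_dist _ _ _ (fun=> 0)) => // i.
by rewrite subrr mul0r addr0 normr0.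
Qed.

Lemma torus_ball_open x z : torus_ball a eps x z ->
  exists2 r : R, 0 < r & forall x',
    (forall i, `|tnth x' i - tnth x i| < r) -> torus_ball a eps x' z.
Proof.
case=> za /torus_dist_lt[m mx].
(* [M] is the distance for one fixed translate [m]; moving the centre by less than the slack
   [eps - M] keeps this [m] valid. *)
pose M := \big[Num.max/0]_(i < d) `|tnth x i - tnth z i + (m i)%:~R * a|.
have Meps : M < eps by apply: bigmax_lt.
exists (eps - M) => [|x' xx']; first by rewrite subr_gt0.
split=> //; apply: (@lt_torus_dist _ _ _ m) => // i.
have -> : tnth x' i - tnth z i + (m i)%:~R * a =
  (tnth x' i - tnth x i) + (tnth x i - tnth z i + (m i)%:~R * a) by lra.
apply: le_lt_trans (ler_normD _ _) _; rewrite -ltrBrDr.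
apply: lt_le_trans (xx' i) _; rewrite lerD2l lerN2.
exact: (le_bigmax_cond _ (fun i => `|tnth x i - tnth z i + (m i)%:~R * a|)).
Qed.

Lemma balls_meet_open x y : balls_meet x y ->
  exists2 r : R, 0 < r & forall x' y',
    (forall i, `|tnth x' i - tnth x i| < r) ->
    (forall i, `|tnth y' i - tnth y i| < r) -> balls_meet x' y'.
Proof.
move=> /asboolP[z [/torus_ball_open[r r0 xr] /torus_ball_open[s s0 ys]]].
exists (Num.min r s) => [|x' y' xx' yy']; first by rewrite lt_min r0.
apply/asboolP; exists z; split.
  by apply: xr => i; have := xx' i; rewrite lt_min => /andP[].
by apply: ys => i; have := yy' i; rewrite lt_min => /andP[].
Qed.

Lemma cech_edge (w : {fset point}) (u v : w) :
  ([set u; v]%SET \in cech_complex a eps w) = balls_meet (val u) (val v).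
Proof.
rewrite inE; have -> : (0 < #|[set u; v]%SET|)%N.
  by apply/card_gt0P; exists u; rewrite !inE eqxx.
rewrite /=; congr (`[< _ !=set0 >]); apply/seteqP; split=> [z uvz|z [uz vz]].
  by split; apply: uvz => /=; rewrite !inE eqxx ?orbT.
by move=> t /=; rewrite !inE => /orP[]/eqP->.
Qed.

Lemma betti0_cechE (w : {fset point}) : [set` w] `<=` torus a ->
  betti0 (cech_complex a eps w) =
  n_comp [rel u v : w | balls_meet (val u) (val v)] predT.
Proof.
move=> wa; rewrite /betti0 (eq_n_comp_r (a' := predT)); last first.
  (* A vertex is treated as a degenerate edge; every point is one, since its ball contains its
     centre. *)
  move=> u; rewrite unfold_in /= -(finset.setUid [set u]%SET) cech_edge.
  by rewrite balls_meet_refl//; exact/wa/valP.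
by apply/eq_n_comp/eq_connect => u v /=; rewrite cech_edge.
Qed.

End CechGraph.

(** * Grid cells, their mesh and their measurability *)

Section Grid.
Context {R : realType} (d : nat) (a : R) (n : nat).
Hypothesis a0 : 0 < a.
Local Notation point := (d.-tuple (measurableTypeR R)).
Local Notation grid := {ffun 'I_d -> 'I_n.+1}.
Implicit Types (x y : point) (Q : grid).

(** For [0 <= r < a] the truncation is below [n.+1], so the fallback value of [inord] never occurs
    there. *)
Definition grid_index (r : R) : 'I_n.+1 := inord (Num.truncn (r * n.+1%:R / a)).

Lemma grid_indexE (r : R) (k : 'I_n.+1) : 0 <= r < a ->
  (grid_index r == k) = (k%:R <= r * n.+1%:R / a < k.+1%:R).
Proof.
move=> /andP[r0 ra].
have s0 : 0 <= r * n.+1%:R / a by rewrite divr_ge0 ?(ltW a0)// mulr_ge0.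
rewrite -truncn_eq// -val_eqE /= inordK// truncn_lt_nat//.
by rewrite ltr_pdivrMr// mulrC ltr_pM2l// ltr0n.
Qed.

(** The rescaled coordinates share a half-open unit interval, hence differ by less than 1. *)
Lemma grid_index_dist (r s : R) : 0 <= r < a -> 0 <= s < a ->
  grid_index r = grid_index s -> `|r - s| < a / n.+1%:R.
Proof.
move=> ra sa rs; have n0 : 0 < n.+1%:R :> R by rewrite ltr0n.
have := esym (grid_indexE (grid_index s) ra); rewrite rs eqxx => /andP[r1 r2].
have := esym (grid_indexE (grid_index s) sa); rewrite eqxx => /andP[s1 s2].
have : `|r * n.+1%:R / a - s * n.+1%:R / a| < 1.
  by rewrite ltr_norml; move: r1 r2 s1 s2; rewrite -[(grid_index s).+1%:R]natr1; lra.
rewrite -mulrA -[s * _ / _]mulrA -mulrBl normrM [X in _ * X]gtr0_norm ?divr_gt0//.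
by rewrite -ltr_pdivlMr ?divr_gt0// mul1r invf_div.
Qed.

Definition grid_of x : grid := [ffun i => grid_index (tnth x i)].

Definition grid_cell Q : set point := [set x | torus a x /\ grid_of x = Q].

Lemma grid_cell_torus Q : grid_cell Q `<=` torus a.
Proof. by move=> x []. Qed.

Lemma grid_cell_dist x y Q i : grid_cell Q x -> grid_cell Q y ->
  `|tnth x i - tnth y i| < a / n.+1%:R.
Proof.
move=> [xa xQ] [ya yQ]; apply: grid_index_dist; [exact: xa|exact: ya|].
by move/ffunP/(_ i) : (etrans xQ (esym yQ)); rewrite !ffunE.
Qed.

Lemma measurable_grid_cell Q : measurable (grid_cell Q).
Proof.
have -> : grid_cell Q = \bigcap_(i in [set: 'I_d]) (@tnth _ _ ^~ i @^-1`
    (`[0, a[%classic `&`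
     (fun r : R => r * n.+1%:R / a) @^-1` `[(Q i)%:R, (Q i).+1%:R[%classic)).
  apply/seteqP; split=> [x [xa xQ] i _|x xQ].
    split; rewrite /= in_itv/=; first exact: xa.
    by rewrite -(grid_indexE _ (xa i)) -xQ ffunE.
  have xa : torus a x by move=> i; have [] := xQ i Logic.I; rewrite /= in_itv.
  split=> //; apply/ffunP => i; rewrite ffunE; apply/eqP; rewrite grid_indexE//.
  by have [_] := xQ i Logic.I; rewrite /= in_itv.
apply: fin_bigcap_measurable => [|i _]; first exact: finite_finset.
rewrite -[X in measurable X]setTI; apply: measurable_tnth => //.
apply: measurableI; first exact: measurable_itv.
rewrite -[X in measurable X]setTI.
suff : measurable_fun setT (fun r : R => r * n.+1%:R / a).
  by apply=> //; exact: measurable_itv.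
by apply: measurable_funM => //; apply: measurable_funM.
Qed.

End Grid.

(** * Approximation by the graph of occupied cells *)

Section GridGraph.
Context {R : realType} (d : nat) (a eps : R).
Hypotheses (a0 : 0 < a) (eps0 : 0 < eps).
Local Notation point := (d.-tuple (measurableTypeR R)).
Local Notation grid n := {ffun 'I_d -> 'I_n.+1}.
Implicit Types (w : {fset point}).

Definition occupied n w : {set grid n} :=
  [set Q | (0 < count_in (grid_cell a Q) w)%N]%SET.

(** Quantifying over all pairs makes adjacency of two cells imply, at every mesh, that the balls
    around points inside them meet. Only the converse needs a fine mesh. *)
Definition cells_meet n (Q Q' : grid n) : bool :=
  `[< forall x y, grid_cell a Q x -> grid_cell a Q' y -> balls_meet a eps x y >].

(** Cutting the relation down to [S] keeps paths inside [S], so the components are those of the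
    induced subgraph. *)
Definition grid_betti0 n (S : {set grid n}) : nat :=
  n_comp [rel Q Q' | [&& Q \in S, Q' \in S & cells_meet Q Q']] (mem S).

Lemma occupiedP n w (Q : grid n) : [set` w] `<=` torus a ->
  reflect (exists u : w, grid_of a n (val u) = Q) (Q \in occupied n w).
Proof.
move=> wa; rewrite inE cardfs_gt0; apply: (iffP (fset0Pn _)).
  move=> [x]; rewrite !inE /= => /andP[xw]; rewrite inE => -[_ xQ].
  by exists (FSetSub xw).
move=> [u uQ]; exists (val u); rewrite !inE/= (valP u)/=.
by rewrite inE; split => //; exact/wa/valP.
Qed.

(* Two points with meeting balls lie in cells all of whose points have meeting
   balls once the mesh is fine enough, so mapping each point to its cell
   identifies the components; coinciding cells do no harm, as the relation is
   also open around the diagonal. *)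
Lemma near_grid_betti0 w : [set` w] `<=` torus a ->
  \forall n \near \oo, betti0 (cech_complex a eps w) = grid_betti0 (occupied n w).
Proof.
move=> wa.
have near_edge (u v : w) : \forall n \near \oo, balls_meet a eps (val u) (val v) ->
    cells_meet (grid_of a n (val u)) (grid_of a n (val v)).
  have [/balls_meet_open|_] := boolP (balls_meet a eps (val u) (val v));
    last exact: nearW.
  move=> /(_ eps0)[r r0 ruv]; have ra0 : 0 < r / a by rewrite divr_gt0.
  have := near_infty_natSinv_lt (PosNum ra0); apply: filterS => n /= nr _.
  have nar : a / n.+1%:R < r by rewrite mulrC -ltr_pdivlMr.
  apply/asboolP => x y xu yv; apply: ruv => i; apply: lt_trans nar.
    by apply: grid_cell_dist xu _ => //; split => //; exact/wa/valP.
  by apply: grid_cell_dist yv _ => //; split => //; exact/wa/valP.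
(* There are finitely many pairs, so one threshold serves them all. *)
have all_edges : \forall n \near \oo, forall u v : w,
    balls_meet a eps (val u) (val v) ->
    cells_meet (grid_of a n (val u)) (grid_of a n (val v)).
  by apply: filter_forall => u; apply: filter_forall => v; exact: near_edge.
apply: filterS all_edges => n edge; rewrite betti0_cechE//.
apply: (@n_comp_quotient _ _ (fun u : w => grid_of a n (val u)))
  => [Q Q'|u v|u|Q Q'|Q|u v].
- rewrite /= andbCA; congr [&& _, _ & _]; apply/asboolP/asboolP => QQ' x y xQ yQ;
  by rewrite balls_meetC; exact: QQ'.
- exact: balls_meetC.
- by rewrite /= balls_meet_refl//; exact/wa/valP.
- by move=> /= /and3P[-> ->].
- exact: occupiedP.
- have uO (u' : w) : grid_of a n (val u') \in occupied n w.
    by apply/occupiedP => //; exists u'.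
  rewrite /= !uO /=; apply/idP/idP => [|/asboolP]; first exact: edge.
  by apply; split => //; exact/wa/valP.
Qed.

End GridGraph.

(** * Measurability of the Betti number *)

Section Measurability.
Context {R : realType} d (Omega : measurableType d) (k : nat) (a eps : R).
Local Notation point := (k.-tuple (measurableTypeR R)).
Hypotheses (a0 : 0 < a) (eps0 : 0 < eps).
Variable w : Omega -> {fset point}.
Hypothesis wa : forall t, [set` w t] `<=` torus a.
Hypothesis mw : forall A, measurable A -> A `<=` torus a ->
  measurable_fun setT (fun t => count_in A (w t)).

(** The occupied set takes finitely many values [S], and each value is prescribed by finitely many
    conditions on counts. *)
Lemma measurable_occupied n (p : pred {set {ffun 'I_k -> 'I_n.+1}}) :
  measurable [set t | p (occupied a n (w t))].
Proof.
have -> : [set t | p (occupied a n (w t))] =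
    \bigcup_(S in [set S | p S]) \bigcap_(Q in [set: {ffun 'I_k -> 'I_n.+1}])
      [set t | (0 < count_in (grid_cell a Q) (w t))%N = (Q \in S)].
  apply/seteqP; split=> [t pt|t [S pS tS]] /=.
    by exists (occupied a n (w t)) => // Q _; rewrite /= inE.
  suff -> : occupied a n (w t) = S by [].
  by apply/setP => Q; rewrite inE; exact: tS.
apply: fin_bigcup_measurable => [|S _]; first exact: finite_finset.
apply: fin_bigcap_measurable => [|Q _]; first exact: finite_finset.
have := mw (measurable_grid_cell a0 Q) (@grid_cell_torus _ _ _ _ Q).
by move=> /(_ measurableT [set m | (0 < m)%N = (Q \in S)] Logic.I); rewrite setTI.
Qed.

(** Eventual equality with the grid count writes the event as a limit inferior of measurable
    events. *)
Lemma measurable_betti0_cech (p : pred nat) :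
  measurable [set t | p (betti0 (cech_complex a eps (w t)))].
Proof.
have -> : [set t | p (betti0 (cech_complex a eps (w t)))] =
    \bigcup_N \bigcap_(n in [set n | (N <= n)%N])
      [set t | p (grid_betti0 a eps (occupied a n (w t)))].
  apply/seteqP; split=> t /=.
    have [N _ Nt] := near_grid_betti0 a0 eps0 (wa (t:=t)).
    by move=> pt; exists N => // n /Nt /= <-.
  move=> [N _ Nt]; have [M _ Mt] := near_grid_betti0 a0 eps0 (wa (t:=t)).
  have := Mt (maxn N M) (leq_maxr _ _) => /= ->.
  exact/Nt/leq_maxl.
apply: bigcup_measurable => N _; apply: bigcap_measurableType => n _.
exact: (measurable_occupied (fun S => p (grid_betti0 a eps S))).
Qed.

End Measurability.

(** * Volume and measurability of the torus *)

(** [lebesgue_tuple] is a bare set function, so its value on the empty set needs an induction; it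
    serves for the empty sections over points outside [[0, a)]. *)
Lemma lebesgue_tuple0 (R : realType) (d : nat) :
  @lebesgue_tuple R d set0 = 0%E.
Proof.
elim: d => [|d IHd] /=; first by rewrite measure0.
rewrite /pushforward preimage_set0 /product_measure1.
by apply: integral0_eq => r _ /=; rewrite xsection0.
Qed.

Lemma lebesgue_tuple_torus (R : realType) (d : nat) (a : R) : 0 < a ->
  lebesgue_tuple (torus (d := d) a) = (a ^+ d)%:E.
Proof.
move=> a0; elim: d => [|d IHd] /=.
  rewrite diracE mem_set ?expr0//.
  by move=> [].
rewrite /pushforward.
have -> : (fun p : measurableTypeR R * d.-tuple (measurableTypeR R) =>
    [tuple of p.1 :: p.2]) @^-1` torus a = `[0, a[%classic `*` torus a.
  apply/seteqP; split=> [[r x] rxa|[r x] [/= ra xa] i] /=.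
    split; first by have := rxa ord0; rewrite tnth0 in_itv.
    by move=> i; have := rxa (lift ord0 i); rewrite tnthS.
  have [j ->|->] := unliftP ord0 i; first by rewrite tnthS; exact: xa.
  by move: ra; rewrite in_itv.
rewrite /product_measure1 /=.
(* The section over [r] is the lower-dimensional torus or empty, so its volume is [a ^+ d] times an
   indicator. *)
transitivity (\int[lebesgue_measure]_(r in [set: measurableTypeR R])
    ((a ^+ d)%:E * (\1_(`[0%R, a[%classic : set (measurableTypeR R)) r)%:E))%E.
  apply: eq_integral => r _; rewrite /= indicE.
  have [ra|ra] := boolP (r \in _); first by rewrite in_xsectionX// IHd mule1.
  rewrite notin_xsectionX// mule0 lebesgue_tuple0//.
rewrite ge0_integralZl//; last 2 first.
- by apply/measurable_EFinP; exact: measurable_indic.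
- by rewrite lee_fin exprn_ge0// ltW.
have leba : lebesgue_measure (`[0, a[%classic : set R) = a%:E.
  by rewrite lebesgue_measure_itv/= lte_fin a0 oppr0 adde0.
by rewrite integral_indic// setIT [X in (_ * X)%E]leba -EFinM exprSr.
Qed.

Lemma measurable_torus (R : realType) (d : nat) (a : R) : measurable (@torus R d a).
Proof.
have -> : torus a = \bigcap_(i in [set: 'I_d])
    (@tnth _ (measurableTypeR R) ^~ i @^-1` `[0, a[%classic).
  by apply/seteqP; split=> [x xa i _|x xa i]; [|have := xa i Logic.I];
    rewrite /= in_itv/=; first exact: xa.
apply: fin_bigcap_measurable => [|i _]; first exact: finite_finset.
by rewrite -[X in measurable X]setTI; apply: measurable_tnth => //;
  exact: measurable_itv.
Qed.

(** * Comparison with the point count and the final estimate *)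

Lemma betti0_cech_le_count (R : realType) (d : nat) (a eps : R)
    (w : {fset d.-tuple (measurableTypeR R)}) : [set` w] `<=` torus a ->
  (betti0 (cech_complex a eps w) <= count_in (torus a) w)%N.
Proof.
move=> wa; apply: leq_trans (max_card _) _; rewrite -cardfE /count_in.
apply/fsubset_leq_card/fsubsetP => x xw; rewrite !inE/= xw/=.
by rewrite inE; exact: wa.
Qed.

(* [(2 ^ d - 1) ^ 2 >= 1] reduces the claim to
   [y - m <= (y + m) / 2 * ln (y / m)]. *)
Lemma poisson_exponent_le (R : realType) (d : nat) (m y : R) :
  (1 <= d)%N -> 0 < m -> m < y ->
  y - m - y * ln (y / m) <=
  - ((y - m) / 2 * ln (1 + (y - m) / ((2 ^+ d - 1) ^+ 2 * m))).
Proof.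
move=> d1 m0 my; have ym0 : 0 < y - m by rewrite subr_gt0.
have c1 : 1 <= (2 ^+ d - 1) ^+ 2 :> R.
  apply: exprn_ege1; rewrite lerBrDr; case: d d1 => // d _.
  by rewrite exprS ler_peMr// exprn_ege1// ler1n.
have lnle : ln (1 + (y - m) / ((2 ^+ d - 1) ^+ 2 * m)) <= ln (y / m).
  have cm0 : 0 < (2 ^+ d - 1) ^+ 2 * m by rewrite mulr_gt0// (lt_le_trans ltr01).
  have -> : y / m = 1 + (y - m) / m by field; rewrite gt_eqF.
  rewrite ler_ln ?posrE ?addr_gt0 ?divr_gt0//.
  by rewrite lerD2l ler_pM2l// lef_pV2 ?posrE// ler_peMl// ltW.
have := @ln_ge_pade R (y / m); rewrite ler_pdivlMr// mul1r => /(_ (ltW my)).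
have -> : 2 * (y / m - 1) / (y / m + 1) = 2 * (y - m) / (y + m).
  by field; rewrite !gt_eqF// ?addr_gt0// (lt_trans m0).
rewrite ler_pdivrMr; last by rewrite addr_gt0// (lt_trans m0).
(* Passing to [ln (y / m)] on the right costs $(y-m)/2$ of it, and $y - (y-m)/2 = (y+m)/2$ is the
   coefficient in the rational bound. *)
have := ler_wpM2l (ltW ym0) lnle.
nra.
Qed.

Theorem theorem13 (R : realType) (disp : measure_display)
  (Omega : measurableType disp) (P : probability Omega R)
  (d : nat) (a lambda eps : R)
  (w : Omega -> {fset d.-tuple (measurableTypeR R)})
  (d_ge1 : (1 <= d)%N) (a_gt0 : 0 < a) (lambda_gt0 : 0 < lambda)
  (eps_gt0 : 0 < eps) (eps_lt : eps < a / 4)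
  (w_poisson : poisson_process P (torus a)
     (fun A => (lambda%:E * lebesgue_tuple A)%E) w)
  (y : R) (y_gt : lambda * a ^+ d < y) :
  (P [set t | (y <= (betti0 (cech_complex a eps (w t)))%:R)%R] <=
   (expR (- ((y - lambda * a ^+ d) / 2 *
      ln (1 + (y - lambda * a ^+ d) /
              ((2 ^+ d - 1) ^+ 2 * (lambda * a ^+ d)))))%R)%:E)%E.
Proof.
have [wa mw pw _] := w_poisson.
have m0 : 0 < lambda * a ^+ d by rewrite mulr_gt0// exprn_gt0.
have mT := @measurable_torus R d a.
apply: (@le_trans _ _ (P ((fun t => count_in (torus a) (w t)) @^-1`
    [set k : nat | (y <= k%:R)%R]))%E).
  (* Monotonicity asks for both events to be measurable; the grid approximation enters for the
     first. *)
  apply: le_measure; rewrite ?inE.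
  - exact: (measurable_betti0_cech a_gt0 eps_gt0 wa mw (fun k => y <= k%:R)).
  - rewrite -[X in measurable X]setTI; exact: mw.
  - move=> t /= yb; apply: le_trans yb _; rewrite ler_nat.
    by apply: betti0_cech_le_count; exact: wa.
(* The count on the whole torus is Poisson with mean [lambda * a ^+ d]. *)
rewrite pw// lebesgue_tuple_torus//=.
by apply: le_trans (poisson_tail m0 y_gt) _;
  rewrite lee_fin ler_expR poisson_exponent_le.
Qed.
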